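(* Let $f$ be a function on $(0,\infty)$ and let $z>0$. If the integrals involved converge absolutely, then $$\mathscr{E}_{2,1}\Big\{\frac{1}{y}\,\mathscr{L}_{2}\{f(x);y\};z\Big\}=\sqrt{\pi}\,\mathscr{P}\Big\{\mathscr{G}\{x\,f(x);u\};z\Big\},$$ where the $\mathscr{E}_{2,1}$-transform is taken in the variable $y$ and the Widder transform $\mathscr{P}$ is taken in the variable $u$, both evaluated at $z$.
   Context: For a function $f$ on $(0,\infty)$ and $y>0$, the following transforms are used: the $\mathscr{L}_2$-transform $$\mathscr{L}_{2}\{f(x);y\}=\int_0^\infty x\,\exp(-x^{2}y^{2})\,f(x)\,dx;$$ the Glasser transform $$\mathscr{G}\{f(x);y\}=\int_{0}^{\infty}\frac{f(x)}{\sqrt{x^{2}+y^{2}}}\,dx;$$ the $\mathscr{E}_{2,1}$-transform $$\mathscr{E}_{2,1}\{f(x);y\}=\int_0^\infty x\,\exp(x^2y^2)\,\mathrm{E}_1(x^2y^2)\,f(x)\,dx,$$ where $\mathrm{E}_1(x)=\int_1^\infty \frac{\exp(-xt)}{t}\,dt$ for $x>0$ is the exponential integral; and the Widder transform $$\mathscr{P}\{f(x);y\}=\int_0^\infty\frac{x\,f(x)}{x^2+y^2}\,dx.$$ *)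

(* Defs.v *)
From HB Require Import structures.
From mathcomp Require Import all_boot all_order all_algebra.
From mathcomp Require Import all_classical all_reals all_analysis.

Set Implicit Arguments.
Unset Strict Implicit.
Unset Printing Implicit Defensive.

Import Order.TTheory GRing.Theory Num.Theory.
Import numFieldNormedType.Exports.

Local Open Scope classical_set_scope.
Local Open Scope ring_scope.

(** Functions on the open half-line are represented by total functions
    [f : R -> R]; every integral below only uses the values of [f] on
    [`]0, +oo[].  Integrals are Lebesgue integrals. *)

Section transforms.
Context {R : realType}.
Implicit Types (K : R -> R -> R) (f : R -> R) (x y : R).

Definition transform K f y : R :=
  \int[lebesgue_measure]_(x in `]0%R, +oo[) (K x y * f x).

(** Absolute convergence of the integral defining [transform K f y].  The
    [Rintegral] above is meaningful only when this holds. *)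
Definition transform_abs_cvg K f y : Prop :=
  (@lebesgue_measure R).-integrable `]0%R, +oo[
    (fun x => (K x y * f x)%:E).

(** Exponential integral; meant for [0 < x], where it converges. *)
Definition expint1 x : R :=
  \int[lebesgue_measure]_(t in `[1%R, +oo[) (expR (- (x * t)) / t).

Definition L2_kernel x y : R := x * expR (- (x ^+ 2 * y ^+ 2)).

Definition glasser_kernel x y : R := (Num.sqrt (x ^+ 2 + y ^+ 2))^-1.

Definition E21_kernel x y : R :=
  x * expR (x ^+ 2 * y ^+ 2) * expint1 (x ^+ 2 * y ^+ 2).

Definition widder_kernel x y : R := x / (x ^+ 2 + y ^+ 2).

Definition L2_transform := transform L2_kernel.
Definition glasser_transform := transform glasser_kernel.
Definition E21_transform := transform E21_kernel.
Definition widder_transform := transform widder_kernel.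

End transforms.

(* Main.v *)
Require Import Defs.
From HB Require Import structures.
From mathcomp Require Import all_boot all_order all_algebra.
From mathcomp Require Import all_classical all_reals all_analysis.
From mathcomp Require Import measurable_realfun.
From mathcomp Require Import ring lra.
Import Order.TTheory GRing.Theory Num.Theory.
Import numFieldNormedType.Exports.
Local Open Scope classical_set_scope.
Local Open Scope ring_scope.

(** Both sides are the iterated integral of
    [2 u / (u ^+ 2 + z ^+ 2) * exp (- y ^+ 2 * u ^+ 2) * L2 f y] over [y] and
    [u].  Integrating in [u] first, the substitution [t = 1 + u ^+ 2 / z ^+ 2]
    in [E_1] produces the kernel of the E_{2,1}-transform.  Integrating in [y]
    first, a Gaussian integral and Fubini's theorem in [(x, y)] produce
    [sqrt pi] times the Glasser transform at [u].  Since the kernels are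
    positive, absolute convergence of the Glasser transform justifies the
    exchange of [x] and [y] at each fixed [u], and absolute convergence of the
    E_{2,1}-transform of [L2 f] justifies that of [y] and [u]; the triple
    integral itself need not converge absolutely. *)

(** * Exchange of iterated real-valued integrals *)

(** Tonelli turns finiteness of the one iterated integral of [|h|] into integrability on the
    product, and Fubini then applies. Sections are assumed integrable at every point, not almost
    every one, because [fine] sends an infinite value to 0: finiteness is what identifies each inner
    real integral with the extended one. *)
Lemma Rintegral_exchange d1 d2 (T1 : measurableType d1)
    (T2 : measurableType d2) (R : realType)
    (m1 : {sigma_finite_measure set T1 -> \bar R})
    (m2 : {sigma_finite_measure set T2 -> \bar R})
    (D1 : set T1) (D2 : set T2) (h : T1 -> T2 -> R) :
  measurable D1 -> measurable D2 ->
  measurable_fun (D1 `*` D2) (fun p => h p.1 p.2) ->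
  (forall x, D1 x -> m2.-integrable D2 (EFin \o h x)) ->
  (forall y, D2 y -> m1.-integrable D1 (EFin \o h^~ y)) ->
  m1.-integrable D1 (fun x => (\int[m2]_(y in D2) `|h x y|)%:E) ->
  m2.-integrable D2 (fun y => (\int[m1]_(x in D1) h x y)%:E) /\
  \int[m1]_(x in D1) \int[m2]_(y in D2) h x y =
  \int[m2]_(y in D2) \int[m1]_(x in D1) h x y.
Proof.
move=> mD1 mD2 mh ih1 ih2 ih.
(* Extension by zero outside the rectangle reduces everything to Fubini on the whole product
   space. *)
pose F : T1 * T2 -> \bar R := EFin \o ((fun p => h p.1 p.2) \_ (D1 `*` D2)).
have mF : measurable_fun [set: T1 * T2] F.
  apply/measurable_EFinP.
  by apply/(measurable_restrictT (fun p => h p.1 p.2)) => //;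
    exact: measurableX.
have FE x y : F (x, y) = if (x \in D1) && (y \in D2) then (h x y)%:E else 0%E.
  by rewrite /F/= patchE in_setX/=; case: ifP.
(* A general [g] vanishing at 0 covers both uses: the absolute value for integrability and the
   identity for the exchange. *)
have intFx (g : R -> R) x : g 0 = 0 ->
    (\int[m2]_y (g (fine (F (x, y))))%:E =
     if x \in D1 then \int[m2]_(y in D2) (g (h x y))%:E else 0)%E.
  move=> g0; case: ifPn => xD.
    rewrite [RHS]integral_mkcond; apply: eq_integral => y _.
    by rewrite FE xD patchE/=; case: ifPn => //=; rewrite g0.
  by rewrite integral0_eq// => y _; rewrite FE (negbTE xD) /= g0.
have intFy y : (\int[m1]_x F (x, y) =
     if y \in D2 then \int[m1]_(x in D1) (h x y)%:E else 0)%E.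
  case: ifPn => yD.
    rewrite [RHS]integral_mkcond; apply: eq_integral => x _.
    by rewrite FE yD andbT patchE.
  by rewrite integral0_eq// => x _; rewrite FE (negbTE yD) andbF.
have finF x y : (fine (F (x, y)))%:E = F (x, y) by rewrite FE; case: ifP.
have RI2 x : D1 x ->
    (\int[m2]_(y in D2) h x y)%:E = (\int[m2]_(y in D2) (h x y)%:E)%E.
  by move=> Dx; rewrite fineK//; apply: integrable_fin_num => //; exact: ih1.
have RI1 y : D2 y ->
    (\int[m1]_(x in D1) h x y)%:E = (\int[m1]_(x in D1) (h x y)%:E)%E.
  by move=> Dy; rewrite fineK//; apply: integrable_fin_num => //; exact: ih2.
have iF : (m1 \x m2)%E.-integrable setT F.
  apply/integrable12ltyP => //.
  have := integrable_lty mD1 ih; congr (_ < _)%E.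
  rewrite integral_mkcond; apply: eq_integral => x _.
  transitivity (\int[m2]_y (`|fine (F (x, y))|)%:E)%E; last first.
    by apply: eq_integral => y _; rewrite -[in RHS]finF.
  rewrite intFx ?normr0// patchE; case: ifPn => // /set_mem Dx.
  rewrite fineK//; apply: integrable_fin_num => //.
  exact/integrable_norm/ih1.
have intF1 x : (\int[m2]_y F (x, y) =
    ((fun x => (\int[m2]_(y in D2) h x y)%:E) \_ D1) x)%E.
  under eq_integral do rewrite -finF.
  rewrite patchE (intFx id)//=.
  by case: ifPn => // /set_mem /RI2 ->.
have intF2 y : (\int[m1]_x F (x, y) =
    ((fun y => (\int[m1]_(x in D1) h x y)%:E) \_ D2) y)%E.
  by rewrite patchE intFy; case: ifPn => // /set_mem /RI1 ->.
split.
  apply/integrable_mkcond => //.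
  (* The integrability of the [y]-marginal is read off the product taken in the opposite order. *)
  have iFs : (m2 \x m1)%E.-integrable setT (fun p => F (p.2, p.1)).
    apply/integrable12ltyP; last first.
      exact: (integrable21ltyP m1 m2 mF).1.
    by apply: measurableT_comp => //; exact: (@measurable_swap _ _ T2 T1).
  have := integrable_fubini_F iFs; apply: eq_integrable => // y _.
  exact: intF2.
congr fine.
rewrite [LHS]integral_mkcond [RHS]integral_mkcond.
under eq_integral do rewrite -intF1.
under [RHS]eq_integral do rewrite -intF2.
exact: Fubini.
Qed.

(** * A scaled Gaussian integral and a quadratic substitution *)

(** Rescale the standard Gaussian integral by [sqrt c]. For [c = x ^+ 2 + u ^+ 2] the factor
    [(sqrt c)^-1] is the Glasser kernel. *)
Lemma integral_gauss_scale (R : realType) (c : R) : 0 < c ->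
  (\int[lebesgue_measure]_(y in `]0%R, +oo[) (expR (- (y ^+ 2 * c)))%:E =
   (Num.sqrt pi / 2 * (Num.sqrt c)^-1)%:E)%E.
Proof.
move=> c0; set s := Num.sqrt c.
have s0 : 0 < s by rewrite sqrtr_gt0.
pose F : R -> R := fun y : R => y * s.
have dF : F^`()%classic = cst s.
  apply/funext => y; rewrite /F derive1Mr//.
  by rewrite derive1E derive_id mul1r.
have mg : measurable_fun setT (fun y : R => (expR (- (y ^+ 2 * c)))%:E).
  apply/measurable_EFinP; apply: measurableT_comp => //.
  by apply: measurable_funN; apply: measurable_funM.
rewrite integral_itv_obnd_cbnd; last exact: measurable_funTS.
have := @integral0y_gauss R.
rewrite [X in `[X, +oo[%classic](_ : 0 = F 0); last by rewrite /F mul0r.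
rewrite increasing_ge0_integration_by_substitutiony//; last first.
- by move=> x _; exact: gauss_fun_ge0.
- by apply: continuous_subspaceT => x; exact: continuous_gauss_fun.
- exact: gt0_cvgMly.
- split; first by move=> x _; exact: derivableM.
  by apply: cvg_at_right_filter; apply: cvgM; [exact: cvg_id | exact: cvg_cst].
- by rewrite dF; exact: is_cvg_cst.
- by rewrite dF; exact: is_cvg_cst.
- by rewrite dF => x _; exact: cvg_cst.
- by move=> x y _ _ xy; rewrite /F ltr_pM2r.
rewrite dF => H.
rewrite mulrC EFinM -H -ge0_integralZl//=; last 3 first.
- apply/measurable_EFinP/measurable_funTS; apply: measurable_funM => //.
  apply: measurableT_comp; first exact: measurable_gauss_fun.
  exact: measurable_funM.
- by move=> x _; rewrite lee_fin mulr_ge0// ?gauss_fun_ge0// ltW.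
- by rewrite lee_fin invr_ge0 ltW.
rewrite /F mul0r; apply: eq_integral => x _; congr EFin => /=.
rewrite -[(_ * _) x]/(gauss_fun (x * s) * s) mulrCA mulVf ?mulr1 ?gt_eqF//.
by rewrite /gauss_fun exprMn sqr_sqrtr// ltW.
Qed.

(* The substitution lemmas on half-lines require the derivative of the change of
   variables to converge at [+oo], which fails here: substitute on [[0, n]] and
   let [n] go to infinity. *)
Lemma integral_sqr_substitution (R : realType) (G : R -> R) (k : R) : 0 < k ->
  {within `[1, +oo[, continuous G} -> {in `[1, +oo[, forall t, 0 <= G t} ->
  (\int[lebesgue_measure]_(t in `[1%R, +oo[) (G t)%:E =
   \int[lebesgue_measure]_(u in `[0%R, +oo[)
     (G (1 + k * u ^+ 2) * (2 * k * u))%:E)%E.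
Proof.
move=> k0 cG G0.
pose F : R -> R := fun u => 1 + k * u ^+ 2.
have dF (x : R) : is_derive x 1 F (2 * k * x).
  rewrite /F; apply: is_derive_eq.
  rewrite add0r mul1r /GRing.scale/= mulr1 -mulr2n -(mulr_natl x).
  by rewrite !mulrA (mulrC k).
have F'E : F^`()%classic = fun u => 2 * k * u.
  by apply/funext => u; rewrite derive1E; apply: derive_val.
have F0 : F 0 = 1 by rewrite /F expr0n mulr0 addr0.
have cF : continuous F.
  by move=> x; apply/differentiable_continuous/derivable1_diffP.
have cF' : continuous F^`()%classic.
  by rewrite F'E => x; apply: cvgM; [exact: cvg_cst|exact: cvg_id].
have Fincr : {in `[0, +oo[ &, {homo F : x y / x < y}}.
  move=> x y; rewrite !in_itv/= !andbT => x0 y0 xy.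
  by rewrite ltrD2l ltr_pM2l// ltrXn2r.
have sub n : (\int[lebesgue_measure]_(t in `[F 0%R, F (n%:R)%R]) (G t)%:E =
   \int[lebesgue_measure]_(u in `[0%R, (n%:R)%R])
     (G (F u) * (2 * k * u))%R%:E)%E.
  rewrite integration_by_substitution_increasing//.
  - by rewrite F'E.
  - move=> x y /[!in_itv]/= /andP[x0 _] /andP[y0 _].
    by apply: Fincr; rewrite in_itv/= ?x0 ?y0.
  - by apply/cvg_ex; exists (F^`()%classic 0); exact/cvg_at_right_filter/cF'.
  - by apply/cvg_ex; exists (F^`()%classic n%:R); exact/cvg_at_left_filter/cF'.
  - split => //.
    + by apply/cvg_at_right_filter/cF.
    + by apply/cvg_at_left_filter/cF.
  - rewrite F0; apply: continuous_subspaceW cG.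
    by apply: subset_itvl.
have Fge1 u : 1 <= F u by rewrite /F lerDl mulr_ge0// ?sqr_ge0// ltW.
have UF : `[1, +oo[%classic = \bigcup_n `[F 0%R, F (n%:R)%R]%classic.
  rewrite F0; apply/seteqP; split => x/=.
    rewrite in_itv/= andbT => x1.
    (* [N >= x / k] gives [k * N >= x], and the successor makes [N] positive, so that [N <= N ^ 2]
       and [F N >= x]. *)
    pose N := (Num.bound (k^-1 * x)).+1.
    exists N => //=; rewrite in_itv/= x1/=.
    rewrite /F; apply: (@le_trans _ _ (k * N%:R)).
      rewrite -ler_pdivrMl// ltW// (lt_le_trans (archi_boundP _)) ?ler_nat//.
      have x0 : 0 <= x by exact: le_trans x1.
      by rewrite mulr_ge0 ?invr_ge0 // ltW.
    rewrite (le_trans (y := k * N%:R ^+ 2))// ?lerDr// ler_pM2l//.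
    rewrite -natrX ler_nat; exact: (@leq_pexp2l N 1 2).
  by move=> [n _]/=; rewrite !in_itv/= => /andP[->].
have U0 : `[0, +oo[%classic = \bigcup_n `[0%R, (n%:R)%R : R]%classic.
  by rewrite itv_bndy_bigcup_BRight; apply: eq_bigcup => // n _; rewrite add0r.
have mG : measurable_fun (`[1%R, +oo[%classic : set R) G.
  exact: subspace_continuous_measurable_fun.
(* Monotone convergence along the exhausting intervals on each side; the two sequences coincide by
   [sub], hence so do their limits. *)
have cv1 : (\int[lebesgue_measure]_(t in `[F 0%R, F (n%:R)%R])
      (G t)%:E @[n --> \oo] -->
    \int[lebesgue_measure]_(t in `[1%R, +oo[) (G t)%:E)%E.
  rewrite UF; apply: ge0_nondecreasing_set_cvg_integral => //.
  - move=> m n mn; rewrite subsetEset; apply: subset_itvl.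
    rewrite bnd_simp /F lerD2l ler_pM2l// lerXn2r ?nnegrE// ?ler0n//.
    by rewrite ler_nat.
  - move=> n; apply/measurable_EFinP; apply: measurable_funS mG => //.
    by rewrite F0; exact: subset_itvl.
  - move=> n x; rewrite F0/= in_itv/= => /andP[x1 _].
    by rewrite lee_fin G0// in_itv/= x1.
have cv2 : (\int[lebesgue_measure]_(u in `[0%R, (n%:R)%R])
      (G (F u) * (2 * k * u))%R%:E @[n --> \oo] -->
    \int[lebesgue_measure]_(u in `[0%R, +oo[) (G (F u) * (2 * k * u))%R%:E)%E.
  rewrite U0; apply: ge0_nondecreasing_set_cvg_integral => //.
  - move=> m n mn; rewrite subsetEset; apply: subset_itvl.
    by rewrite bnd_simp ler_nat.
  - move=> n; apply/measurable_EFinP; apply: measurable_funM.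
      apply: (measurable_comp (F := (`[1%R, +oo[%classic : set R))) => //.
        by move=> _ [u _ <-]; rewrite /= in_itv/= Fge1.
      by apply: measurable_funTS; exact: continuous_measurable_fun.
    exact: measurable_funM.
  - move=> n x; rewrite /= in_itv/= => /andP[x0 _].
    by rewrite lee_fin mulr_ge0 ?G0 ?in_itv/= ?Fge1// mulr_ge0// mulr_ge0// ltW.
move: cv1; under eq_fun do rewrite sub; move=> cv1.
exact: (cvg_unique (@ereal_hausdorff R) cv1 cv2).
Qed.

(** * The two inner integrals: exponential integral and Glasser transform *)

Section half_line.
Context {R : realType}.
Implicit Types (f : R -> R) (u y z c : R).

Local Notation mu := (@lebesgue_measure R).
Local Notation D := (`]0%R, +oo[%classic : set (measurableTypeR R)).

Let mD : measurable D. Proof. by []. Qed.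

Lemma integrable_gauss_scale c : 0 < c ->
  mu.-integrable D (fun y => (expR (- (y ^+ 2 * c)))%:E).
Proof.
move=> c0; apply/integrableP; split.
  apply/measurable_EFinP; apply: measurableT_comp => //.
  by apply: measurable_funN; apply: measurable_funM.
under eq_integral do rewrite gee0_abs ?lee_fin ?expR_ge0//.
by rewrite integral_gauss_scale// ltry.
Qed.

Lemma measurable_widder_kernel z : 0 < z ->
  measurable_fun setT (widder_kernel ^~ z).
Proof.
move=> z0; apply: continuous_measurable_fun => u.
apply: cvgM; first exact: cvg_id.
apply: cvgV; first by rewrite gt_eqF// ltr_wpDl ?sqr_ge0 ?exprn_gt0.
by apply: cvgD; [exact: exprn_continuous|exact: cvg_cst].
Qed.

(* AM-GM: [2 u z <= u ^+ 2 + z ^+ 2] bounds the Widder kernel. *)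
Lemma integrable_widder_gauss y z : 0 < y -> 0 < z ->
  mu.-integrable D (fun u =>
    (widder_kernel u z * expR (- (u ^+ 2 * y ^+ 2)))%:E).
Proof.
move=> y0 z0; have y20 : 0 < y ^+ 2 by rewrite exprn_gt0.
have ig := integrable_gauss_scale _ y20.
apply: (le_integrable mD _ _ (integrableZl mD (2 * z)^-1 ig)).
  apply/measurable_EFinP; apply: measurable_funM.
    by apply: measurable_funTS; exact: measurable_widder_kernel.
  by have /integrableP[/measurable_EFinP] := integrable_gauss_scale _ y20.
move=> u /=; rewrite in_itv/= andbT => u0.
have uz : 0 < u ^+ 2 + z ^+ 2 by rewrite addr_gt0// exprn_gt0.
rewrite lee_fin !normrM ler_wpM2r// /widder_kernel.
rewrite !ger0_norm ?divr_ge0 ?invr_ge0 ?mulr_ge0 ?(ltW u0) ?(ltW uz)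
  ?(ltW z0)//.
rewrite ler_pdivrMr// ler_pdivlMl ?mulr_gt0//.
have := sqr_ge0 (u - z); lra.
Qed.

(** Put [a = y ^+ 2 * z ^+ 2] and [t = 1 + u ^+ 2 / z ^+ 2]. Then [a * t = a + u ^+ 2 * y ^+ 2] and
    [dt / t = 2 * u / (u ^+ 2 + z ^+ 2) du], while the prefactor [exp a] cancels [exp (- a)]. *)
Lemma exp_expint1E y z : 0 < y -> 0 < z ->
  expR (y ^+ 2 * z ^+ 2) * expint1 (y ^+ 2 * z ^+ 2) =
  2 * \int[mu]_(u in D) (widder_kernel u z * expR (- (u ^+ 2 * y ^+ 2))).
Proof.
move=> y0 z0; set a := y ^+ 2 * z ^+ 2.
have iw := integrable_widder_gauss y z y0 z0.
have k0 : 0 < (z ^+ 2)^-1 by rewrite invr_gt0 exprn_gt0.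
rewrite /expint1 /Rintegral (integral_sqr_substitution _ _ _ k0); last 2 first.
- apply: continuous_in_subspaceT => t /set_mem/=; rewrite in_itv/= andbT => t1.
  apply: cvgM.
    apply: continuous_comp; last exact: continuous_expR.
    by apply: cvgN; apply: cvgM; [exact: cvg_cst|exact: cvg_id].
  by apply: cvgV; [rewrite gt_eqF// (lt_le_trans ltr01)|exact: cvg_id].
- move=> t; rewrite in_itv/= andbT => t1.
  by rewrite divr_ge0 ?expR_ge0// (le_trans ler01).
have E u : expR (- (a * (1 + (z ^+ 2)^-1 * u ^+ 2))) /
    (1 + (z ^+ 2)^-1 * u ^+ 2) *
    (2 * (z ^+ 2)^-1 * u) =
    expR (- a) * 2 * (widder_kernel u z * expR (- (u ^+ 2 * y ^+ 2))).
  have z2 : z != 0 by rewrite gt_eqF.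
  have uz : u ^+ 2 + z ^+ 2 != 0.
    by rewrite gt_eqF// ltr_wpDl ?sqr_ge0 ?exprn_gt0.
  rewrite (_ : - (a * _) = - a - u ^+ 2 * y ^+ 2); last by rewrite /a; field.
  rewrite expRD /widder_kernel; field.
  by rewrite z2 uz.
rewrite [in LHS](eq_integral (fun u : measurableTypeR R => (expR (- a) * 2 *
  (widder_kernel u z * expR (- (u ^+ 2 * y ^+ 2))))%:E)); last first.
  by move=> u _; rewrite -E.
rewrite -integral_itv_obnd_cbnd; last first.
  apply/measurable_EFinP; apply: measurable_funM => //.
  by have /integrableP[/measurable_EFinP] := iw.
rewrite -/(Rintegral mu D (fun u =>
  expR (- a) * 2 * (widder_kernel u z * expR (- (u ^+ 2 * y ^+ 2))))).
by rewrite RintegralZl// mulrA mulrA -expRD subrr expR0 mul1r.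
Qed.

(** The two exponentials merge into [exp (- y ^+ 2 * (x ^+ 2 + u ^+ 2))], whose integral in [y] is
    [sqrt pi / 2] times the Glasser kernel. The integrability conclusion supplies the sections in
    [y] for the exchange of [y] and [u]. *)
Lemma glasser_gauss f u : 0 < u ->
  (forall y, 0 < y -> transform_abs_cvg L2_kernel f y) ->
  transform_abs_cvg glasser_kernel (fun x => x * f x) u ->
  mu.-integrable D (fun y =>
    (expR (- (u ^+ 2 * y ^+ 2)) * L2_transform f y)%:E) /\
  \int[mu]_(y in D) (expR (- (u ^+ 2 * y ^+ 2)) * L2_transform f y) =
  Num.sqrt pi / 2 * glasser_transform (fun x => x * f x) u.
Proof.
move=> u0 hL2 hG.
pose h x y : R := expR (- (y ^+ 2 * (x ^+ 2 + u ^+ 2))) * (x * f x).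
have c0 x : 0 < x ^+ 2 + u ^+ 2 by rewrite ltr_wpDl ?sqr_ge0 ?exprn_gt0.
have hE x y : h x y = expR (- (u ^+ 2 * y ^+ 2)) * (L2_kernel x y * f x).
  rewrite /h /L2_kernel.
  rewrite (_ : - _ = - (u ^+ 2 * y ^+ 2) - x ^+ 2 * y ^+ 2); last by ring.
  by rewrite expRD; ring.
(* Measurability is extracted from the L2 integrand at [y = 1] by undoing the factor
   [exp (- x ^+ 2)]. *)
have mxf : measurable_fun D (fun x => x * f x).
  have /integrableP[/measurable_EFinP m1 _] := hL2 1 ltr01.
  have me : measurable_fun D (fun x => expR (x ^+ 2)).
    by apply: measurableT_comp => //; exact: measurable_funX.
  apply: eq_measurable_fun (measurable_funM me m1) => x _ /=.
  rewrite /L2_kernel expr1n mulr1 [x * expR _]mulrC -mulrA mulrA.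
  by rewrite expRxMexpNx_1 mul1r.
have hx x c : \int[mu]_(y in D) (c * expR (- (y ^+ 2 * (x ^+ 2 + u ^+ 2)))) =
    c * (Num.sqrt pi / 2 * glasser_kernel x u).
  rewrite RintegralZl//; last exact: integrable_gauss_scale.
  by rewrite /Rintegral integral_gauss_scale.
have hy y : 0 < y ->
    \int[mu]_(x in D) h x y = expR (- (u ^+ 2 * y ^+ 2)) * L2_transform f y.
  move=> y0; under eq_Rintegral do rewrite hE.
  by rewrite RintegralZl//; exact: hL2.
have [||||ih2 E] := @Rintegral_exchange _ _ _ _ R mu mu D D h mD mD.
- apply: measurable_funM.
  + apply: measurable_funTS; apply: measurableT_comp => //.
    apply: measurable_funN; apply: measurable_funM.
      by apply: measurable_funX; exact: measurable_snd.
    apply: measurable_funD; last exact: measurable_cst.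
    by apply: measurable_funX; exact: measurable_fst.
  + apply: (measurable_comp (F := D)) mxf _ => //.
    * by move=> _ [[x y] [Dx Dy] <-].
    * by apply: measurable_funTS; exact: measurable_fst.
- move=> x _.
  have := integrableZl mD (x * f x) (integrable_gauss_scale _ (c0 x)).
  by apply: eq_integrable => // y _; rewrite -EFinM mulrC.
- move=> y /=; rewrite in_itv/= andbT => y0.
  have := integrableZl mD (expR (- (u ^+ 2 * y ^+ 2))) (hL2 y y0).
  by apply: eq_integrable => // x _ /=; rewrite hE.
(* By positivity of the Gaussian, the integral of [|h x y|] in [y] is [sqrt pi / 2] times the
   absolute value of the Glasser integrand, so [hG] is the required bound. *)
- have := integrable_norm (integrableZl mD (Num.sqrt pi / 2) hG).
  apply: eq_integrable => // x _ /=; congr EFin.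
  under eq_Rintegral do rewrite /h mulrC normrM (ger0_norm (expR_ge0 _)).
  have K0 : 0 <= Num.sqrt pi / 2 * glasser_kernel x u.
    by rewrite mulr_ge0// ?divr_ge0 ?invr_ge0 ?sqrtr_ge0.
  by rewrite hx -[X in _ = _ * X](ger0_norm K0) -normrM; congr `|_|; ring.
- split.
    apply: eq_integrable ih2 => // y /set_mem/=; rewrite in_itv/= andbT => y0.
    by rewrite hy.
  under eq_Rintegral.
    move=> y /set_mem/=; rewrite in_itv/= andbT => y0; rewrite -hy//; over.
  rewrite /= -E /glasser_transform /transform -RintegralZl//.
  apply: eq_Rintegral => x _.
  under eq_Rintegral do rewrite /h mulrC.
  by rewrite hx; ring.
Qed.

End half_line.

(** * Exchange of [y] and [u], and the identity *)

Theorem corollary12 (R : realType) (f : R -> R) (z : R) (hz : 0 < z)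
  (hL2 : forall y : R, 0 < y -> transform_abs_cvg L2_kernel f y)
  (hE21 : transform_abs_cvg E21_kernel (fun y => y^-1 * L2_transform f y) z)
  (hG : forall u : R, 0 < u ->
     transform_abs_cvg glasser_kernel (fun x => x * f x) u)
  (hP : transform_abs_cvg widder_kernel
     (fun u => glasser_transform (fun x => x * f x) u) z) :
  E21_transform (fun y => y^-1 * L2_transform f y) z =
  Num.sqrt pi *
  widder_transform (fun u => glasser_transform (fun x => x * f x) u) z.
Proof.
pose mu := @lebesgue_measure R.
pose D : set (measurableTypeR R) := `]0%R, +oo[%classic.
have mD : measurable D by exact: measurable_itv.
have D0 x : D x -> 0 < x by rewrite /D/= in_itv/= andbT.
have two : (2 : R) != 0 by rewrite pnatr_eq0.
pose g := L2_transform f.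
pose G := glasser_transform (fun x => x * f x).
have gG u : 0 < u -> _ := fun u0 => glasser_gauss f u u0 hL2 (hG u u0).
(* The variable [x] is already integrated out inside [g]. The factor 2 of [exp_expint1E] is left out
   of [h], so integrating in [u] gives [H y / 2 * g y]. *)
pose h y u : R := widder_kernel u z * expR (- (u ^+ 2 * y ^+ 2)) * g y.
pose H y : R := expR (y ^+ 2 * z ^+ 2) * expint1 (y ^+ 2 * z ^+ 2).
have E21E y : 0 < y -> E21_kernel y z * (y^-1 * g y) = H y * g y.
  by move=> y0; rewrite /E21_kernel /H; field; rewrite gt_eqF.
(* As for [x * f x] above: the integrand at [u = 1] is multiplied by [exp (y ^+ 2)]. *)
have mg : measurable_fun D g.
  have [/integrableP[/measurable_EFinP m1 _] _] := gG 1 ltr01.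
  have me : measurable_fun D (fun y => expR (y ^+ 2)).
    by apply: measurableT_comp => //; exact: measurable_funX.
  apply: eq_measurable_fun (measurable_funM me m1) => y _ /=.
  by rewrite expr1n mul1r mulrA expRxMexpNx_1 mul1r.
have H0 y : 0 <= H y / 2.
  rewrite divr_ge0// mulr_ge0 ?expR_ge0//; apply: Rintegral_ge0 => t /=.
  by rewrite in_itv/= andbT => t1;
    rewrite divr_ge0 ?expR_ge0// (le_trans ler01).
have hw y c : 0 < y ->
    \int[mu]_(u in D) (c * (widder_kernel u z * expR (- (u ^+ 2 * y ^+ 2)))) =
    c * (H y / 2).
  move=> y0; rewrite RintegralZl//; last exact: integrable_widder_gauss.
  by rewrite /H exp_expint1E// [2 * _]mulrC mulfK ?pnatr_eq0.
have hu u : 0 < u ->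
    \int[mu]_(y in D) h y u = widder_kernel u z * (Num.sqrt pi / 2 * G u).
  move=> u0; under eq_Rintegral do rewrite /h -mulrA.
  by rewrite RintegralZl// ?(gG u u0).2// (gG u u0).1.
have [||||_ E] := @Rintegral_exchange _ _ _ _ R mu mu D D h mD mD.
- apply: measurable_funM.
  + apply: measurable_funTS; apply: measurable_funM.
      exact: measurableT_comp (measurable_widder_kernel z hz) measurable_snd.
    apply: measurableT_comp => //.
    apply: measurable_funN; apply: measurable_funM; apply: measurable_funX.
      exact: measurable_snd.
    exact: measurable_fst.
  + apply: (measurable_comp (F := D)) mg _ => //.
    * by move=> _ [[x y] [Dx Dy] <-].
    * by apply: measurable_funTS; exact: measurable_fst.
- move=> y /D0 y0.
  have := integrableZl mD (g y) (integrable_widder_gauss _ _ y0 hz).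
  by apply: eq_integrable => // u _; rewrite -EFinM mulrC.
- move=> u /D0 u0.
  have := integrableZl mD (widder_kernel u z) (gG u u0).1.
  by apply: eq_integrable => // y _; rewrite -EFinM mulrA.
(* Since the Widder and Gaussian factors are nonnegative, integrating [|h y u|] in [u] gives
   [|g y| * (H y / 2)], half the absolute value of the integrand in [hE21]. *)
- have := integrable_norm (integrableZl mD 2^-1 hE21).
  apply: eq_integrable => // y /set_mem/D0 y0 /=; congr EFin.
  rewrite E21E// [RHS](_ : _ = `|g y| * (H y / 2)).
    rewrite -(ger0_norm (H0 y)) -normrM; congr `|_|; ring.
  rewrite -hw//; apply: eq_Rintegral => u /set_mem/D0 u0.
  rewrite /h normrM mulrC; congr (_ * _).
  rewrite ger0_norm// mulr_ge0// ?expR_ge0//.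
  by rewrite /widder_kernel divr_ge0// ?addr_ge0 ?sqr_ge0// ltW.
have -> : E21_transform (fun y => y^-1 * g y) z =
    2 * \int[mu]_(y in D) \int[mu]_(u in D) h y u.
  have -> : \int[mu]_(y in D) \int[mu]_(u in D) h y u =
      \int[mu]_(y in D) (2^-1 * (E21_kernel y z * (y^-1 * g y))).
    apply: eq_Rintegral => y /set_mem/D0 y0.
    under eq_Rintegral do rewrite /h mulrC.
    rewrite (hw _ _ y0) (E21E _ y0).
    by rewrite mulrA mulrC [g y * _]mulrC.
  rewrite RintegralZl; [|exact: mD|exact: hE21].
  rewrite (mulVKf two).
  reflexivity.
rewrite E.
have -> : \int[mu]_(u in D) \int[mu]_(y in D) h y u =
    \int[mu]_(u in D) (Num.sqrt pi / 2 * (widder_kernel u z * G u)).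
  apply: eq_Rintegral => u /set_mem/D0 u0.
  by rewrite (hu _ u0) mulrCA.
rewrite RintegralZl; [|exact: mD|exact: hP].
(* The 2 from the exponential integral cancels the half of the half-line Gaussian, leaving
   [sqrt pi]. *)
rewrite mulrA mulrCA (divff two) mulr1.
reflexivity.
Qed.
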